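(* Let $\mathcal{S}\in\mathbb{M}$ be a background model with $\langle\mathcal{L}_{\gtrdot};\mathcal{L}_{\lessdot}\rangle\subseteq\mathcal{S}$. Then $\mathcal{S}$ is compatible with every coherent prevision on $\mathcal{L}$, i.e., for every coherent prevision $P$ on $\mathcal{L}$ the assessment $\mathcal{N}_P=\langle\{f\in\mathcal{L}:P f>0\};\{f\in\mathcal{L}:P f<0\}\rangle$ respects $\mathcal{S}$, if and only if $\mathcal{S}\subset\langle\mathcal{L}_{\geq};\mathcal{L}_{\leq}\rangle$.
   Context: Let $\Omega$ be a non-empty set and let $\mathcal{L}$ be a real linear subspace of the vector space of all real-valued functions (''gambles'') on $\Omega$ with pointwise operations; $\mathcal{L}$ is assumed to contain the constant gambles. Put $\mathcal{L}_{\gtrdot}=\{f\in\mathcal{L}:\inf f>0\}$, $\mathcal{L}_{\lessdot}=\{f\in\mathcal{L}:\sup f<0\}$, $\mathcal{L}_{\geq}=\{f\in\mathcal{L}:\inf f\geq0\}$, $\mathcal{L}_{\leq}=\{f\in\mathcal{L}:\sup f\leq0\}$. A coherent prevision on $\mathcal{L}$ is a real linear functional $P$ on $\mathcal{L}$ with $\inf f\leq P f\leq\sup f$ for all $f\in\mathcal{L}$. For $\mathcal{K},\mathcal{K}'\subseteq\mathcal{L}$: $\mathcal{K}-\mathcal{K}'=\{f-g:f\in\mathcal{K},g\in\mathcal{K}'\}$; $\overline{\mathcal{K}}=\{\lambda f:\lambda>0,f\in\mathcal{K}\}$; $\operatorname{posi}\mathcal{K}$ is the set of all linear combinations with strictly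 positive coefficients of non-empty finite families of elements of $\mathcal{K}$. A cone is a set $\mathcal{K}\subseteq\mathcal{L}$ with $\operatorname{posi}\mathcal{K}=\mathcal{K}$. An assessment is a pair $\mathcal{A}=\langle\mathcal{A}_{\mathrm{acc}};\mathcal{A}_{\mathrm{rej}}\rangle$ of subsets of $\mathcal{L}$; inclusion $\subseteq$ and union are component-wise, and $\mathcal{A}\subset\mathcal{B}$ means $\mathcal{A}\subseteq\mathcal{B}$ and $\mathcal{A}\neq\mathcal{B}$. A model without confusion is an assessment $\mathcal{M}$ such that $\mathcal{M}_{\mathrm{acc}}\cap\mathcal{M}_{\mathrm{rej}}=\emptyset$, $\mathcal{M}_{\mathrm{acc}}$ is a cone, and $\overline{\mathcal{M}_{\mathrm{rej}}}\cup(\overline{\mathcal{M}_{\mathrm{rej}}}-\mathcal{M}_{\mathrm{acc}})\subseteq\mathcal{M}_{\mathrm{rej}}$; the set of these is $\mathbb{M}$. An assessment $\mathcal{A}$ respects $\mathcal{S}\in\mathbb{M}$ if some maximal element of $(\mathbb{M},\subseteq)$ dominates both $\mathcal{A}$ and $\mathcal{S}$; equivalently, if $\operatorname{posi}(\mathcal{A}_{\mathrm{acc}}\cup\mathcal{S}_{\mathrm{acc}})\cap(\mathcal{A}_{\mathrm{rej}}\cup\mathcal{S}_{\mathrm{rej}})=\emptyset$. *)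

(* Defs.v *)
From HB Require Import structures.
From mathcomp Require Import all_boot all_order all_algebra.
From mathcomp Require Import all_classical all_reals ereal.

Set Implicit Arguments.
Unset Strict Implicit.
Unset Printing Implicit Defensive.

Import Order.TTheory GRing.Theory Num.Theory.

Local Open Scope classical_set_scope.
Local Open Scope ring_scope.

Section GambleType.
Context (R : realType) (Omega : Type) (L : submodClosed (Omega -> R^o)).

(* Elements of L as a type: gamble L is an R-module in its own right, so the
   sets of gambles, positive hulls and functionals below all live on L.
   R^o is R viewed as a module over itself. *)
Record gamble := Gamble { gamble_val :> Omega -> R^o ; _ : gamble_val \in L }.

HB.instance Definition _ := [isSub for gamble_val].
HB.instance Definition _ := [Choice of gamble by <:].
HB.instance Definition _ := [SubChoice_isSubLmodule of gamble by <:].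

End GambleType.

Section Assessments.
Context (R : realType) (Omega : Type) (L : submodClosed (Omega -> R^o)).
Local Notation G := (gamble L).

(* Gambles may be unbounded, so inf and sup are extended reals. *)
Definition ginf (f : G) : \bar R := ereal_inf (range (fun w => (f w : R)%:E)).
Definition gsup (f : G) : \bar R := ereal_sup (range (fun w => (f w : R)%:E)).

Definition uniformly_pos : set G := [set f | (0 < ginf f)%E].
Definition uniformly_neg : set G := [set f | (gsup f < 0)%E].
Definition nonneg_gambles : set G := [set f | (0 <= ginf f)%E].
Definition nonpos_gambles : set G := [set f | (gsup f <= 0)%E].

Definition coherent_prevision (P : {scalar G}) : Prop :=
  forall f : G, (ginf f <= (P f)%:E)%E /\ ((P f)%:E <= gsup f)%E.

Definition minkowski_diff (K K' : set G) : set G :=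
  [set f - g | f in K & g in K'].

Definition positive_scalings (K : set G) : set G :=
  [set l *: f | l in [set l : R | 0 < l] & f in K].

Definition posi (K : set G) : set G :=
  [set f | exists (n : nat) (c : 'I_n.+1 -> R) (g : 'I_n.+1 -> G),
     (forall i, 0 < c i) /\ (forall i, K (g i)) /\
     f = \sum_(i < n.+1) c i *: g i].

Definition is_cone (K : set G) : Prop := posi K = K.

Record assessment := Assessment { acc : set G ; rej : set G }.

Definition sub_assessment (A B : assessment) : Prop :=
  acc A `<=` acc B /\ rej A `<=` rej B.

Definition proper_sub_assessment (A B : assessment) : Prop :=
  sub_assessment A B /\ A <> B.

Definition model_without_confusion (M : assessment) : Prop :=
  [/\ acc M `&` rej M = set0,
      is_cone (acc M) &
      positive_scalings (rej M)
        `|` minkowski_diff (positive_scalings (rej M)) (acc M) `<=` rej M].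

Definition maximal_model (M : assessment) : Prop :=
  model_without_confusion M /\
  forall M', model_without_confusion M' -> sub_assessment M M' -> M' = M.

Definition respects (A S : assessment) : Prop :=
  exists M, [/\ maximal_model M, sub_assessment A M & sub_assessment S M].

Definition prevision_assessment (P : {scalar G}) : assessment :=
  Assessment [set f | 0 < P f] [set f | P f < 0].

End Assessments.

(* Main.v *)
Require Import Defs.
From HB Require Import structures.
From mathcomp Require Import all_boot all_order all_algebra.
From mathcomp Require Import all_classical all_reals ereal.

(** A cone K and its complement always form a maximal model without confusion:
    if f is outside K, then so are all l f with l > 0 and all f - g with g in
    K, for otherwise f would be a positive combination of elements of K; and a
    disjoint pair that covers all gambles cannot be enlarged ([maximal_cone]).

    Suppose that S lies below the pair of nonnegative and nonpositive gambles,
    and let P be coherent.  Then P is nonnegative on the accepted gambles of S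
    and nonpositive on the rejected ones, so the union K of the accepted gambles
    of S with {P > 0} is a cone ([cone_setU_pos]).  It is disjoint from the
    rejected gambles of S and from {P < 0}, so K and its complement form a
    maximal model dominating both assessments.

    Conversely, evaluation at a point w is a coherent prevision
    ([evaluation_coherent]).  If an accepted f had f w < 0, or a rejected f had
    f w > 0, a model dominating S and the assessment of that evaluation would
    both accept and reject f.  The inclusion is proper because the zero gamble
    is both nonnegative and nonpositive, which a model without confusion
    excludes. *)

Set Implicit Arguments.
Unset Strict Implicit.
Unset Printing Implicit Defensive.

Import Order.TTheory GRing.Theory Num.Theory.

Local Open Scope classical_set_scope.
Local Open Scope ring_scope.

Section Cones.
Context (R : realType) (Omega : Type) (L : submodClosed (Omega -> R^o)).
Local Notation G := (gamble L).
Implicit Types (K : set G) (f g : G).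

Lemma is_coneP K :
  is_cone K <->
  (forall (l : R) f, 0 < l -> K f -> K (l *: f)) /\
  (forall f g, K f -> K g -> K (f + g)).
Proof.
split=> [coneK|[KZ KD]].
  split=> [l f l0 Kf|f g Kf Kg]; rewrite -coneK.
    exists 0%N, (fun=> l), (fun=> f); split=> //; split=> //.
    by rewrite big_ord1.
  exists 1%N, (fun=> 1), (fun i => if i == ord0 then f else g).
  split=> [i|]; first exact: ltr01.
  split=> [i|]; first by case: ifP.
  by rewrite big_ord_recl big_ord1 !scale1r.
rewrite /is_cone; apply/seteqP; split=> f.
  move=> [n [c [g [c0 [Kg ->]]]]].
  elim: n c g c0 Kg => [|n IHn] c g c0 Kg.
    by rewrite big_ord1; apply: KZ.
  by rewrite big_ord_recl; apply: KD; [apply: KZ|apply: IHn].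
move=> Kf; exists 0%N, (fun=> 1), (fun=> f); split=> [i|]; first exact: ltr01.
by split=> //; rewrite big_ord1 scale1r.
Qed.

(** This gives maximal models explicitly, without Zorn's lemma. *)
Lemma maximal_cone K : is_cone K -> maximal_model (Assessment K (~` K)).
Proof.
move=> coneK; have [KZ KD] := (is_coneP K).1 coneK.
have KcZ (l : R) f : 0 < l -> ~ K f -> ~ K (l *: f).
  move=> l0 nKf Klf; apply: nKf.
  (* f = l^-1 *: (l *: f) *)
  rewrite -[f]scale1r -(mulVf (lt0r_neq0 l0)) -scalerA.
  by apply: KZ; rewrite ?invr_gt0.
split.
  split=> /=; [exact: setICr|exact: coneK|].
  move=> _ [[l l0 [f nKf <-]]|[_ [l l0 [f nKf <-]] [g Kg <-]]].
    exact: KcZ.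
  (* l *: f = (l *: f - g) + g *)
  by move=> /KD /(_ Kg); rewrite subrK; apply: KcZ.
move=> [A B] [/= AB0 _ _] [/= KA KB]; congr Assessment; apply/seteqP; split=> //.
- move=> f Af; apply: contrapT => nKf.
  by have : (A `&` B) f by [split=> //; apply: KB]; rewrite AB0.
- move=> f Bf Kf.
  by have : (A `&` B) f by [split=> //; apply: KA]; rewrite AB0.
Qed.

(** As P is nonnegative on K, a sum with one term in {P > 0} and the other in K
    stays in {P > 0}. *)
Lemma cone_setU_pos K (P : {scalar G}) :
  is_cone K -> (forall f, K f -> 0 <= P f) ->
  is_cone (K `|` [set f | 0 < P f]).
Proof.
move=> /is_coneP [KZ KD] P0; apply/is_coneP; split=> [l f l0|f g].
  move=> [Kf|/= Pf]; [by left; apply: KZ|right].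
  by rewrite /= linearZ /= mulr_gt0.
move=> [Kf|/= Pf] [Kg|/= Pg]; first by left; apply: KD.
- by right; rewrite /= linearD ltr_wpDl ?P0.
- by right; rewrite /= linearD ltr_wpDr ?P0.
- by right; rewrite /= linearD addr_gt0.
Qed.

End Cones.

Section Gambles.
Context (R : realType) (Omega : Type) (L : submodClosed (Omega -> R^o)).
Local Notation G := (gamble L).
Implicit Types f : G.

Lemma nonneg_gamblesP f : nonneg_gambles f <-> forall w, 0 <= f w :> R.
Proof.
split=> [f0 w|f0].
  by rewrite -lee_fin; apply: le_trans f0 _; apply: ereal_inf_lbound; exists w.
by apply: le_ereal_inf_tmp => _ [w _ <-]; rewrite lee_fin.
Qed.

Lemma nonpos_gamblesP f : nonpos_gambles f <-> forall w, f w <= 0 :> R.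
Proof.
split=> [f0 w|f0].
  by rewrite -lee_fin; apply: le_trans f0; apply: ereal_sup_ubound; exists w.
by apply: ge_ereal_sup => _ [w _ <-]; rewrite lee_fin.
Qed.

Lemma coherent_ge0 (P : {scalar G}) f :
  coherent_prevision P -> nonneg_gambles f -> 0 <= P f.
Proof. by move=> /(_ f) [fP _] f0; rewrite -lee_fin (le_trans f0). Qed.

Lemma coherent_le0 (P : {scalar G}) f :
  coherent_prevision P -> nonpos_gambles f -> P f <= 0.
Proof. by move=> /(_ f) [_ Pf] f0; rewrite -lee_fin (le_trans Pf). Qed.

(** Evaluation of gambles at the point w; a linear functional. *)
Definition evaluation (w : Omega) (f : G) : R := f w.

Lemma evaluation_is_scalar w : scalar (evaluation w).
Proof. by []. Qed.

HB.instance Definition _ w :=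
  GRing.isLinear.Build R G R *%R (evaluation w) (evaluation_is_scalar w).

Lemma evaluation_coherent w : coherent_prevision (evaluation w).
Proof.
by move=> f; split; [apply: ereal_inf_lbound|apply: ereal_sup_ubound]; exists w.
Qed.

(** Two assessments dominated by a common model do not contradict each other. *)
Lemma respects_disjoint (A S : assessment L) :
  respects A S -> acc A `&` rej S = set0 /\ acc S `&` rej A = set0.
Proof.
move=> [M [[[M0 _ _] _] [AaM ArM] [SaM SrM]]].
split; rewrite -subset0 -M0; exact: setISS.
Qed.

End Gambles.

Theorem proposition5p4 (R : realType) (Omega : Type)
  (Omega_neq0 : [set: Omega] !=set0)
  (L : submodClosed (Omega -> R^o))
  (L_cst : forall c : R, (fun _ : Omega => c) \in L)
  (S : assessment L)
  (S_model : model_without_confusion S)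
  (S_background :
    sub_assessment (Assessment (@uniformly_pos R Omega L)
                               (@uniformly_neg R Omega L)) S) :
  (forall P : {scalar gamble L}, coherent_prevision P ->
     respects (prevision_assessment P) S)
  <->
  proper_sub_assessment S
    (Assessment (@nonneg_gambles R Omega L) (@nonpos_gambles R Omega L)).
Proof.
have [S0 coneS _] := S_model.
split=> [resp|[[Sacc Srej] _] P cohP]; last first.
  have accP f : acc S f -> 0 <= P f.
    by move=> /Sacc; apply: coherent_ge0.
  have rejP f : rej S f -> P f <= 0.
    by move=> /Srej; apply: coherent_le0.
  exists (Assessment (acc S `|` [set f | 0 < P f])
                     (~` (acc S `|` [set f | 0 < P f]))).
  split; first exact: maximal_cone (cone_setU_pos coneS accP).
  - split=> f /= Pf; first by right.
    by move=> [/accP|]; [rewrite leNgt Pf|move/lt_trans => /(_ _ Pf); rewrite ltxx].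
  - split=> f Sf; first by left.
    case=> [aSf|/=]; last by rewrite ltNge rejP.
    by have : (acc S `&` rej S) f by []; rewrite S0.
have respw w := respects_disjoint (resp _ (evaluation_coherent (L:=L) w)).
split; last first.
  move=> SE; have : (acc S `&` rej S) 0.
    by rewrite SE; split; [apply/nonneg_gamblesP|apply/nonpos_gamblesP].
  by rewrite S0.
split=> f Sf.
- apply/nonneg_gamblesP => w; rewrite leNgt; apply/negP => fw.
  suff : (acc S `&` [set g | evaluation w g < 0]) f by rewrite (respw w).2.
  by split.
- apply/nonpos_gamblesP => w; rewrite leNgt; apply/negP => fw.
  suff : ([set g | 0 < evaluation w g] `&` rej S) f by rewrite (respw w).1.
  by split.
Qed.
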